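(* Let $G$ and $H$ be finite simple graphs. Suppose that $H$ is not well-covered and $G$ has an isolatable vertex. Then the Cartesian product $G\,\square\, H$ is not well-covered.
   Context: A graph is well-covered if every maximal independent set of vertices has the same cardinality. A vertex $x$ of $G$ is isolatable if there is an independent set $M$ of $G$ such that $G-N[M]$ consists of the single vertex $x$, where $N[M]$ is the closed neighborhood of $M$. The Cartesian product $G\,\square\, H$ has vertex set $V(G)\times V(H)$, with $(x_1,x_2)$ adjacent to $(y_1,y_2)$ if either $x_1=y_1$ and $x_2y_2\in E(H)$, or $x_1y_1\in E(G)$ and $x_2=y_2$. *)

(* Defs.v *)
From mathcomp Require Import all_boot.

Set Implicit Arguments.
Unset Strict Implicit.
Unset Printing Implicit Defensive.

(* A finite simple graph is a symmetric irreflexive adjacency relation on a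
   finType of vertices. *)
Definition simple_graph (V : finType) (e : rel V) : Prop :=
  symmetric e /\ irreflexive e.

Definition independent (V : finType) (e : rel V) (A : {set V}) : bool :=
  [forall x in A, forall y in A, ~~ e x y].

(* Maximality is with respect to inclusion. *)
Definition maximal_independent (V : finType) (e : rel V) (A : {set V}) : bool :=
  maxset (independent e) A.

Definition well_covered (V : finType) (e : rel V) : Prop :=
  forall A B : {set V},
    maximal_independent e A -> maximal_independent e B -> #|A| = #|B|.

Definition closed_neighborhood (V : finType) (e : rel V) (M : {set V}) :
    {set V} :=
  M :|: [set y | [exists x in M, e x y]].

(* M may be empty: the vertex of a one-vertex graph is isolatable. *)
Definition isolatable (V : finType) (e : rel V) (x : V) : Prop :=
  exists2 M : {set V},
    independent e M & ~: closed_neighborhood e M = [set x].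

Definition cartesian_product (V W : finType) (eG : rel V) (eH : rel W) :
    rel (V * W) :=
  fun p q => ((p.1 == q.1) && eH p.2 q.2) || (eG p.1 q.1 && (p.2 == q.2)).

Lemma cartesian_product_simple (V W : finType) (eG : rel V) (eH : rel W) :
  simple_graph eG -> simple_graph eH ->
  simple_graph (cartesian_product eG eH).
Proof.
move=> [sG iG] [sH iH]; split=> [p q|p]; rewrite /cartesian_product.
  by rewrite (eq_sym p.1) (eq_sym p.2) sG sH.
by rewrite iG iH andbF.
Qed.

(* Main.v *)
Require Import Defs.
From mathcomp Require Import all_boot.

Set Implicit Arguments.
Unset Strict Implicit.
Unset Printing Implicit Defensive.

(** Let M isolate x in G, let A and B be maximal independent sets of H, and let
    S be a maximal independent set of the product containing M x B and {x} x A.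
    By maximality of A, the fiber of S over x is exactly {x} x A.  Replacing this
    fiber by {x} x B preserves independence: a neighbor v of x lies in N(M), so
    for b in B the vertex (v, b) is adjacent to a vertex of M x B and is not in S.
    If the product is well-covered, then |B| <= |A|, and |A| = |B| by symmetry. *)

Lemma independentP (V : finType) (e : rel V) (A : {set V}) :
  reflect {in A &, forall x y, ~~ e x y} (independent e A).
Proof.
apply: (iffP forall_inP) => [h x y xA yA|h x xA]; first exact: (forall_inP (h x xA)).
by apply/forall_inP => y; apply: h.
Qed.

Lemma independentS (V : finType) (e : rel V) (A B : {set V}) :
  A \subset B -> independent e B -> independent e A.
Proof.
by move=> /subsetP AB /independentP iB; apply/independentP=> x y /AB xB /AB; apply: iB.
Qed.

Lemma independentU (V : finType) (e : rel V) (A B : {set V}) :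
  symmetric e -> independent e A -> independent e B ->
  {in A & B, forall x y, ~~ e x y} -> independent e (A :|: B).
Proof.
move=> se /independentP iA /independentP iB iAB; apply/independentP=> x y.
case/setUP=> xX /setUP[] yX; [exact: iA | exact: iAB | | exact: iB].
by rewrite se; apply: iAB.
Qed.

Lemma independent_set1 (V : finType) (e : rel V) (x : V) :
  irreflexive e -> independent e [set x].
Proof. by move=> ie; apply/independentP=> u v /set1P-> /set1P->; rewrite ie. Qed.

(** Otherwise [y] could be added to [A], against maximality. *)
Lemma maximal_independent_dominates (V : finType) (e : rel V) (A : {set V}) (y : V) :
  simple_graph e -> maximal_independent e A -> y \notin A -> exists2 z, z \in A & e z y.
Proof.
move=> [se ie] /maxsetP[iA maxA] yA.
suff /existsP[z /andP[zA zy]] : [exists z, (z \in A) && e z y] by exists z.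
apply: contraNT yA => /existsPn noz.
rewrite -(maxA (A :|: [set y])) ?subsetUl ?in_setU ?set11 ?orbT //.
apply: independentU => //; first exact: independent_set1.
by move=> u v uA /set1P->; have := noz u; rewrite uA.
Qed.

(** An edge of the product projects to an edge in one of the two factors, hence to an edge inside
    [M] or inside [B]. *)
Lemma independent_setX (V W : finType) (eG : rel V) (eH : rel W)
    (M : {set V}) (B : {set W}) :
  independent eG M -> independent eH B ->
  independent (cartesian_product eG eH) (setX M B).
Proof.
move=> /independentP iM /independentP iB; apply/independentP=> [[u a] [v b]].
case/setXP=> uM aB /setXP[vM bB]; rewrite /cartesian_product /=.
by rewrite (negbTE (iM _ _ uM vM)) (negbTE (iB _ _ aB bB)) andbF.
Qed.

Lemma closed_neighborhoodP (V : finType) (e : rel V) (M : {set V}) (v : V) :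
  reflect (v \in M \/ exists2 m, m \in M & e m v) (v \in closed_neighborhood e M).
Proof.
by rewrite !inE; apply: (iffP orP) => -[vM|/exists_inP mv]; [left|right|left|right].
Qed.

Lemma leq_card_maximal_independent (V W : finType) (eG : rel V) (eH : rel W)
    (x : V) (A B : {set W}) :
  simple_graph eG -> simple_graph eH -> isolatable eG x ->
  well_covered (cartesian_product eG eH) ->
  maximal_independent eH A -> maximal_independent eH B -> #|B| <= #|A|.
Proof.
move=> simpleG simpleH [M iM Mx] wc maxA maxB.
have [_ iG] := simpleG.
have [sP _] := cartesian_product_simple simpleG simpleH.
have [iA iB] := (maxsetp maxA, maxsetp maxB).
have NMx v : (v \in closed_neighborhood eG M) = (v != x).
  by apply: negb_inj; rewrite negbK -in_setC Mx inE.
have xNM : x \notin closed_neighborhood eG M by rewrite NMx eqxx.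
have xM m : m \in M -> m != x.
  by move=> mM; rewrite -NMx; apply/closed_neighborhoodP; left.
have Mxadj m : m \in M -> ~~ eG m x.
  by move=> mM; apply: contra xNM => mx; apply/closed_neighborhoodP; right; exists m.
(* A vertex of [M] is neither equal nor adjacent to [x], so both clauses of product adjacency fail
   between the two blocks. *)
have iS0 : independent (cartesian_product eG eH) (setX M B :|: setX [set x] A).
  apply: independentU => //; try by apply: independent_setX; rewrite ?independent_set1.
  move=> [m b] [u a] /setXP[mM _] /setXP[/set1P-> _].
  by rewrite /cartesian_product /= (negbTE (xM m mM)) (negbTE (Mxadj m mM)).
have [S maxS /subUsetP[/subsetP MBS /subsetP xAS]] := maxset_exists iS0.
have /independentP iS := maxsetp maxS.
pose R := [set p in S | p.1 != x].
have subS : S \subset R :|: setX [set x] A.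
  apply/subsetP=> [[u w]] uwS; rewrite !inE uwS /=; case: eqVneq uwS => //= -> xwS.
  (* If [w] were outside [A], some [a] in [A] would be adjacent to it, giving an edge inside the
     fiber of [S] over [x]. *)
  apply/negPn/negP=> /(maximal_independent_dominates simpleH maxA)[a aA aw].
  have xaS : (x, a) \in S by apply: xAS; rewrite !inE eqxx.
  by have := iS _ _ xaS xwS; rewrite /cartesian_product /= eqxx aw.
have iT : independent (cartesian_product eG eH) (R :|: setX [set x] B).
  apply: independentU => //.
  - apply: independentS (maxsetp maxS).
    by apply/subsetP=> p; rewrite inE => /andP[].
  - by apply: independent_setX; rewrite ?independent_set1.
  move=> [v w] [u b]; rewrite inE /= => /andP[vwS vx] /setXP[/set1P-> bB].
  (* Since [v] differs from [x], an edge from [(v, w)] to [(x, b)] can only come from an edge of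
     [eG], which forces [w = b]. *)
  rewrite /cartesian_product /= (negbTE vx) /=; apply/negP=> /andP[evx /eqP wb].
  move: vx; rewrite -NMx => /closed_neighborhoodP[vM|[m mM mv]].
    by case/negP: (Mxadj v vM).
  have mbS : (m, b) \in S by apply: MBS; apply/setXP.
  by have := iS _ _ mbS vwS; rewrite /cartesian_product /= wb mv eqxx orbT.
(* The exchanged set need not be maximal, so it is extended to [T]; only an inequality on its size
   is needed. *)
have [T maxT subT] := maxset_exists iT.
(* Disjointness makes the lower bound on [#|S|] exact, so that [#|R| + #|B| <= #|T| = #|S| <= #|R| +
   #|A|], where the last bound holds for any union. *)
have disj : [disjoint R & setX [set x] B].
  by apply/pred0P=> [[u w]]; rewrite !inE /=; case: eqVneq; rewrite !(andbF, andbT).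
have leRB := subset_leq_card subT.
rewrite -(wc S T maxS maxT) cardsU disjoint_setI0 // cards0 subn0 in leRB.
have leRA := leq_trans (subset_leq_card subS) (leq_card_setU _ _).
by have := leq_trans leRB leRA; rewrite !cardsX !cards1 !mul1n leq_add2l.
Qed.

Theorem theorem4 (V W : finType) (eG : rel V) (eH : rel W)
    (simpleG : simple_graph eG) (simpleH : simple_graph eH)
    (nwcH : ~ well_covered eH)
    (isoG : exists x : V, isolatable eG x) :
  ~ well_covered (cartesian_product eG eH).
Proof.
move=> wc; apply: nwcH => A B maxA maxB; have [x isox] := isoG.
by apply/eqP; rewrite eqn_leq !(leq_card_maximal_independent simpleG simpleH isox wc).
Qed.
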